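(* Each of the following two verification condition providers yields lower bounds for $\mathrm{awp}$ and is preserved by $\mathrm{trans}^{\succeq}_{\mathrm{awp}}$: (1) $\mathsf{dASTSUBINV}$, where for $C=\mathtt{while}(\varphi)\{C_{\mathrm{body}}\}[I]$ and $f\in\mathbb{E}$, $\mathsf{dASTSUBINV}(C,f)=\mathsf{true}$ iff $[\varphi]\cdot\mathrm{awp}^*[\![C_{\mathrm{body}}]\!](I)+[\neg\varphi]\cdot f\ge I$, $C$ is dAST, and $I$ and $f$ are bounded by some constant $b\in\mathbb{R}_{\ge0}$; (2) $\mathsf{dPASTSUBINV}$, where for $C=\mathtt{while}(\varphi)\{C_{\mathrm{body}}\}[I]$ and $f\in\mathbb{E}$, $\mathsf{dPASTSUBINV}(C,f)=\mathsf{true}$ iff $[\varphi]\cdot\mathrm{awp}^*[\![C_{\mathrm{body}}]\!](I)+[\neg\varphi]\cdot f\ge I$, $C$ is dPAST, and $C$ is suitable for optional stopping w.r.t. $f$.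
   Context: States: fix a countably infinite set of program variables with values in $\mathbb{Q}_{\ge 0}$; a state is a map $\sigma$ from variables to $\mathbb{Q}_{\ge0}$ which is $0$ for all but finitely many variables; $\mathsf{States}$ is the set of states. A predicate is a map $\varphi:\mathsf{States}\to\{\mathsf{true},\mathsf{false}\}$; $\varphi\models\psi$ means every state satisfying $\varphi$ satisfies $\psi$; $\models\varphi$ means $\varphi$ holds in every state; $\varphi\Rightarrow\psi$ is the usual implication. Expectations: $\mathbb{E}$ is the set of maps $\mathsf{States}\to[0,\infty]$, ordered pointwise; $+,\cdot$ pointwise with $0\cdot\infty=0$; $\sqcap,\sqcup$ pointwise min/max; $[\varphi]$ Iverson bracket; $(\varphi\to g)(\sigma)=g(\sigma)$ if $\sigma\models\varphi$, else $\infty$; $f[x/E](\sigma)=f(\sigma[x\mapsto E(\sigma)])$; $f$ is bounded by $b$ if $f(\sigma)\le b$ for all $\sigma$. Programs of $\mathsf{pGCL}$: $C ::= \mathtt{skip} \mid x:=E \mid C;C \mid \mathtt{if}\ \varphi_1\to C\ \square\ \varphi_2\to C \mid \{C\}[p]\{C\} \mid \mathtt{while}(\varphi)\{C\}[I]$, where $E:\mathsf{States}\to\mathbb{Q}_{\ge0}$, $p:\mathsf{States}\to[0,1]$, in every guarded choice $\varphi_1\vee\varphi_2$ is valid (when both hold the choice is nondeterministic), and every loop carries an invariant annotation $I\in\mathbb{E}$. Weakest preexpectations for $\mathcal{T}\in\{\mathrm{dwp},\mathrm{awp}\}$: $\mathcal{T}[\![\mathtt{skip}]\!](f)=f$; $\mathcal{T}[\![x:=E]\!](f)=f[x/E]$;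 $\mathcal{T}[\![C_1;C_2]\!](f)=\mathcal{T}[\![C_1]\!](\mathcal{T}[\![C_2]\!](f))$; $\mathrm{dwp}$ of a guarded choice: $(\varphi_1\to\mathrm{dwp}[\![C_1]\!](f))\sqcap(\varphi_2\to\mathrm{dwp}[\![C_2]\!](f))$; $\mathrm{awp}$ of a guarded choice: $[\varphi_1]\cdot\mathrm{awp}[\![C_1]\!](f)\sqcup[\varphi_2]\cdot\mathrm{awp}[\![C_2]\!](f)$; $\mathcal{T}[\![\{C_1\}[p]\{C_2\}]\!](f)=p\cdot\mathcal{T}[\![C_1]\!](f)+(1-p)\cdot\mathcal{T}[\![C_2]\!](f)$; loops: least fixpoint of $g\mapsto[\neg\varphi]\cdot f+[\varphi]\cdot\mathcal{T}[\![C']\!](g)$. $\mathrm{awp}^*$ follows the $\mathrm{awp}$ rules except $\mathrm{awp}^*[\![\mathtt{while}(\varphi)\{C'\}[I]]\!](f)=I$. Termination notions: $C$ is dAST (demonically almost-surely terminating) if $\mathrm{dwp}[\![C]\!](1)=1$. $C$ is dPAST (positively demonically almost-surely terminating) if its expected runtime (in the sense of the expected-runtime calculus of Kaminski et al., where nondeterminism is resolved in the worst case, i.e. maximizing runtime) is finite for all initial states. A loop $\mathtt{while}(\varphi)\{C_{\mathrm{body}}\}[I]$ is suitable for optional stopping w.r.t. $f$ if (i) $I=[\varphi]\cdot I'+[\neg\varphi]\cdot f$ for some $I'\in\mathbb{E}$, (ii) $f$, $I$ and $[\varphi]\cdot\mathrm{awp}[\![C_{\mathrm{body}}]\!](I)+[\neg\varphi]\cdot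 f$ are all pointwise $<\infty$, and (iii) there is $b\in\mathbb{R}_{\ge0}$ such that for all states $\sigma$, $([\varphi]\cdot\mathrm{awp}[\![C_{\mathrm{body}}]\!](\lambda\tau.|I(\tau)-I(\sigma)|))(\sigma)\le b$. Implementation relation $\multimap$: smallest partial order on $\mathsf{pGCL}$ closed under: if $C_1'\multimap C_1$, $C_2'\multimap C_2$ then $C_1';C_2'\multimap C_1;C_2$ and $\{C_1'\}[p]\{C_2'\}\multimap\{C_1\}[p]\{C_2\}$; if moreover $\varphi_1'\models\varphi_1$, $\varphi_2'\models\varphi_2$, $\models\varphi_1'\vee\varphi_2'$ then $\mathtt{if}\ \varphi_1'\to C_1'\ \square\ \varphi_2'\to C_2'\multimap\mathtt{if}\ \varphi_1\to C_1\ \square\ \varphi_2\to C_2$; if $C'\multimap C$ then $\mathtt{while}(\varphi)\{C'\}\multimap\mathtt{while}(\varphi)\{C\}$. Verification conditions: a provider $\mathfrak{C}$ maps annotated loops and $f\in\mathbb{E}$ to truth values; $\mathrm{vc}^{\mathfrak{C},\mathrm{awp}}[\![C]\!](f)$: $\mathsf{true}$ for $\mathtt{skip}$ and assignments; $\mathrm{vc}[\![C_1]\!](\mathrm{awp}^*[\![C_2]\!](f))\wedge\mathrm{vc}[\![C_2]\!](f)$ for $C_1;C_2$; $\mathrm{vc}[\![C_1]\!](f)\wedge\mathrm{vc}[\![C_2]\!](f)$ for guarded and probabilistic choices; $\mathfrak{C}(\mathtt{while}(\varphi)\{C'\}[I],f)\wedge\mathrm{vc}[\![C']\!](I)$ for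 loops. $\mathfrak{C}$ yields lower bounds for $\mathrm{awp}$ if for all $C\in\mathsf{pGCL}$, $f\in\mathbb{E}$, $\mathrm{vc}^{\mathfrak{C},\mathrm{awp}}[\![C]\!](f)$ implies $\mathrm{awp}[\![C]\!](f)\ge\mathrm{awp}^*[\![C]\!](f)$. Transformer $\mathrm{trans}^{\succeq}_{\mathrm{awp}}$ (with $f\succeq g$ the predicate true at $\sigma$ iff $f(\sigma)\ge g(\sigma)$): $\mathtt{skip}$, assignments unchanged; $C_1;C_2\mapsto \mathrm{trans}[\![C_1]\!](\mathrm{awp}^*[\![C_2]\!](f));\mathrm{trans}[\![C_2]\!](f)$; $\mathtt{if}\ \varphi_1\to C_1\ \square\ \varphi_2\to C_2\mapsto\mathtt{if}\ \psi_1\to\mathrm{trans}[\![C_1]\!](f)\ \square\ \psi_2\to\mathrm{trans}[\![C_2]\!](f)$ with $\psi_1=\varphi_1\wedge(\varphi_2\Rightarrow\mathrm{awp}^*[\![C_1]\!](f)\succeq\mathrm{awp}^*[\![C_2]\!](f))$, $\psi_2=\varphi_2\wedge(\varphi_1\Rightarrow\mathrm{awp}^*[\![C_2]\!](f)\succeq\mathrm{awp}^*[\![C_1]\!](f))$; probabilistic choice transformed branchwise; $\mathtt{while}(\varphi)\{C'\}[I]\mapsto\mathtt{while}(\varphi)\{\mathrm{trans}[\![C']\!](I)\}[I]$. $\mathrm{trans}^{\succeq}_{\mathrm{awp}}$ preserves $\mathfrak{C}$ if for all $C,C'$, $f$: $\mathrm{vc}^{\mathfrak{C},\mathrm{awp}}[\![C]\!](f)$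 and $C'\multimap\mathrm{trans}^{\succeq}_{\mathrm{awp}}[\![C]\!](f)$ imply $\mathrm{vc}^{\mathfrak{C},\mathrm{awp}}[\![C']\!](f)$. *)

(* Defs.v *)
From HB Require Import structures.
From mathcomp Require Import all_boot all_order all_algebra.
From mathcomp Require Import boolp classical_sets constructive_ereal reals ereal Rstruct.
Set Implicit Arguments. Unset Strict Implicit. Unset Printing Implicit Defensive.
Import Order.TTheory GRing.Theory Num.Theory.
Local Open Scope ring_scope.

Notation R := Rdefinitions.R.

Definition Qnn := {q : rat | 0 <= q}.
Definition fin_supp (s : nat -> Qnn) : Prop :=
  exists n, forall x, (n <= x)%N -> val (s x) = 0.
Definition States := {s : nat -> Qnn | fin_supp s}.

Lemma upd_fin (s : States) (x : nat) (v : Qnn) :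
  fin_supp (fun y => if y == x then v else sval s y).
Proof.
case: (svalP s) => n Hn; exists (maxn n x.+1) => y Hy.
have Hxy : y != x.
  apply/eqP => Exy; move: Hy; rewrite Exy geq_max ltnn andbF //.
rewrite (negbTE Hxy); apply: Hn; apply: leq_trans Hy; exact: leq_maxl.
Qed.

Definition upd (s : States) (x : nat) (v : Qnn) : States :=
  exist _ _ (upd_fin s x v).

Definition Pred := States -> bool.
Definition Exp := States -> \bar R.

Local Open Scope ereal_scope.

Definition nonneg (f : Exp) : Prop := forall s, 0 <= f s.
Definition iv (b : bool) : \bar R := if b then 1 else 0.
Definition exp_le (f g : Exp) : Prop := forall s, f s <= g s.

(* least fixed point on the complete lattice E of [0,oo]-valued maps
   (Knaster-Tarski: meet of all prefixed points in E) *)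
Definition lfp (Phi : Exp -> Exp) : Exp :=
  fun s => ereal_inf [set g s | g in [set g | nonneg g /\ exp_le (Phi g) g]].

Definition guardE (phi : Pred) (g : Exp) : Exp :=
  fun s => if phi s then g s else +oo.

Inductive Prog : Type :=
| Skip
| Assign (x : nat) (E : States -> Qnn)
| Seq (C1 C2 : Prog)
| GChoice (phi1 phi2 : Pred) (hvalid : forall s, phi1 s || phi2 s) (C1 C2 : Prog)
| PChoice (p : States -> R) (hp : forall s, ((0 <= p s) && (p s <= 1))%R) (C1 C2 : Prog)
| While (phi : Pred) (C : Prog) (Inv : Exp) (hI : nonneg Inv).
Arguments GChoice : clear implicits.
Arguments PChoice : clear implicits.
Arguments While : clear implicits.

Definition subst (f : Exp) (x : nat) (E : States -> Qnn) : Exp :=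
  fun s => f (upd s x (E s)).

Definition loopF (phi : Pred) (f : Exp) (body : Exp -> Exp) : Exp -> Exp :=
  fun g s => iv (~~ phi s) * f s + iv (phi s) * body g s.

Fixpoint dwp (C : Prog) (f : Exp) : Exp :=
  match C with
  | Skip => f
  | Assign x E => subst f x E
  | Seq C1 C2 => dwp C1 (dwp C2 f)
  | GChoice phi1 phi2 _ C1 C2 =>
      fun s => mine (guardE phi1 (dwp C1 f) s) (guardE phi2 (dwp C2 f) s)
  | PChoice p _ C1 C2 =>
      fun s => (p s)%:E * dwp C1 f s + (1 - p s)%:E * dwp C2 f s
  | While phi C' _ _ => lfp (loopF phi f (dwp C'))
  end.

Fixpoint awp (C : Prog) (f : Exp) : Exp :=
  match C with
  | Skip => f
  | Assign x E => subst f x E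
  | Seq C1 C2 => awp C1 (awp C2 f)
  | GChoice phi1 phi2 _ C1 C2 =>
      fun s => maxe (iv (phi1 s) * awp C1 f s) (iv (phi2 s) * awp C2 f s)
  | PChoice p _ C1 C2 =>
      fun s => (p s)%:E * awp C1 f s + (1 - p s)%:E * awp C2 f s
  | While phi C' _ _ => lfp (loopF phi f (awp C'))
  end.

Fixpoint awps (C : Prog) (f : Exp) : Exp :=
  match C with
  | Skip => f
  | Assign x E => subst f x E
  | Seq C1 C2 => awps C1 (awps C2 f)
  | GChoice phi1 phi2 _ C1 C2 =>
      fun s => maxe (iv (phi1 s) * awps C1 f s) (iv (phi2 s) * awps C2 f s)
  | PChoice p _ C1 C2 =>
      fun s => (p s)%:E * awps C1 f s + (1 - p s)%:E * awps C2 f s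
  | While _ _ Inv _ => Inv
  end.

(* Expected runtime calculus (Kaminski et al.), demonic = worst case (max). *)
Fixpoint ert (C : Prog) (t : Exp) : Exp :=
  match C with
  | Skip => fun s => 1 + t s
  | Assign x E => fun s => 1 + subst t x E s
  | Seq C1 C2 => ert C1 (ert C2 t)
  | GChoice phi1 phi2 _ C1 C2 =>
      fun s => 1 + maxe (iv (phi1 s) * ert C1 t s) (iv (phi2 s) * ert C2 t s)
  | PChoice p _ C1 C2 =>
      fun s => 1 + ((p s)%:E * ert C1 t s + (1 - p s)%:E * ert C2 t s)
  | While phi C' _ _ =>
      lfp (fun g s => 1 + (iv (~~ phi s) * t s + iv (phi s) * ert C' g s))
  end.

Definition one : Exp := fun _ => 1.
Definition zero : Exp := fun _ => 0.

Definition dAST (C : Prog) : Prop := dwp C one = one.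
Definition dPAST (C : Prog) : Prop := forall s, ert C zero s < +oo.

Definition bounded_by (f : Exp) (b : R) : Prop := forall s, f s <= b%:E.

Definition suitable_OST (C : Prog) (f : Exp) : Prop :=
  match C with
  | While phi Cb Inv _ =>
      (exists Inv' : Exp, nonneg Inv' /\
         forall s, Inv s = iv (phi s) * Inv' s + iv (~~ phi s) * f s)
      /\ (forall s, f s < +oo)
      /\ (forall s, Inv s < +oo)
      /\ (forall s, iv (phi s) * awp Cb Inv s + iv (~~ phi s) * f s < +oo)
      /\ (exists b : R, (0 <= b)%R /\
            forall s, iv (phi s) * awp Cb (fun t => `|Inv t - Inv s|) s <= b%:E)
  | _ => False
  end.

Definition entails (phi psi : Pred) : Prop := forall s, phi s -> psi s.

Inductive impl : Prog -> Prog -> Prop :=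
| impl_refl C : impl C C
| impl_trans C1 C2 C3 : impl C1 C2 -> impl C2 C3 -> impl C1 C3
| impl_seq C1' C2' C1 C2 :
    impl C1' C1 -> impl C2' C2 -> impl (Seq C1' C2') (Seq C1 C2)
| impl_pchoice p hp hp' C1' C2' C1 C2 :
    impl C1' C1 -> impl C2' C2 -> impl (PChoice p hp' C1' C2') (PChoice p hp C1 C2)
| impl_gchoice phi1' phi2' h' phi1 phi2 h C1' C2' C1 C2 :
    impl C1' C1 -> impl C2' C2 -> entails phi1' phi1 -> entails phi2' phi2 ->
    impl (GChoice phi1' phi2' h' C1' C2') (GChoice phi1 phi2 h C1 C2)
| impl_while phi Inv hI hI' C' C :
    impl C' C -> impl (While phi C' Inv hI') (While phi C Inv hI).

Notation "C' '-o' C" := (impl C' C) (at level 70).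

Definition provider := Prog -> Exp -> Prop.

Fixpoint vc (P : provider) (C : Prog) (f : Exp) : Prop :=
  match C with
  | Skip => True
  | Assign _ _ => True
  | Seq C1 C2 => vc P C1 (awps C2 f) /\ vc P C2 f
  | GChoice _ _ _ C1 C2 => vc P C1 f /\ vc P C2 f
  | PChoice _ _ C1 C2 => vc P C1 f /\ vc P C2 f
  | While phi C' Inv hI => P (While phi C' Inv hI) f /\ vc P C' Inv
  end.

Definition yields_lower_bounds (P : provider) : Prop :=
  forall (C : Prog) (f : Exp), nonneg f -> vc P C f -> exp_le (awps C f) (awp C f).

Definition psi1 (phi1 phi2 : Pred) (a1 a2 : Exp) : Pred :=
  fun s => phi1 s && (phi2 s ==> (a2 s <= a1 s)).
Definition psi2 (phi1 phi2 : Pred) (a1 a2 : Exp) : Pred :=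
  fun s => phi2 s && (phi1 s ==> (a1 s <= a2 s)).

Lemma psi_valid (phi1 phi2 : Pred) (h : forall s, phi1 s || phi2 s) (a1 a2 : Exp) :
  forall s, psi1 phi1 phi2 a1 a2 s || psi2 phi1 phi2 a1 a2 s.
Proof.
move=> s; rewrite /psi1 /psi2.
move: (h s); case: (phi1 s); case: (phi2 s) => //= _.
by case: (leP (a2 s) (a1 s)) => // /ltW ->; rewrite orbT.
Qed.

Fixpoint trans (C : Prog) (f : Exp) : Prog :=
  match C with
  | Skip => Skip
  | Assign x E => Assign x E
  | Seq C1 C2 => Seq (trans C1 (awps C2 f)) (trans C2 f)
  | GChoice phi1 phi2 h C1 C2 =>
      GChoice (psi1 phi1 phi2 (awps C1 f) (awps C2 f))
        (psi2 phi1 phi2 (awps C1 f) (awps C2 f)) (psi_valid h (awps C1 f) (awps C2 f)) (trans C1 f) (trans C2 f)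
  | PChoice p hp C1 C2 => PChoice p hp (trans C1 f) (trans C2 f)
  | While phi C' Inv hI => While phi (trans C' Inv) Inv hI
  end.

Definition preserved_by_trans (P : provider) : Prop :=
  forall (C C' : Prog) (f : Exp), nonneg f ->
    vc P C f -> C' -o trans C f -> vc P C' f.

Definition subinv (C : Prog) (f : Exp) : Prop :=
  match C with
  | While phi Cb Inv _ =>
      exp_le Inv (fun s => iv (phi s) * awps Cb Inv s + iv (~~ phi s) * f s)
  | _ => False
  end.

Definition dASTSUBINV : provider := fun C f =>
  match C with
  | While _ _ Inv _ =>
      subinv C f /\ dAST C /\
      exists b : R, (0 <= b)%R /\ bounded_by Inv b /\ bounded_by f b
  | _ => False
  end.

Definition dPASTSUBINV : provider := fun C f =>
  match C with
  | While _ _ _ _ => subinv C f /\ dPAST C /\ suitable_OST C f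
  | _ => False
  end.

(* Main.v *)
(* Let L be the angelic value of the loop and d the positive part of I - L.
   Subadditivity of awp turns the subinvariant into d <= [phi] * awp C d, and
   the claim is d = 0.

   dAST: d is bounded, so fix b >= d.  If d + e <= b then awp d + dwp e <= b,
   hence b - d is a prefixed point of the demonic loop with postexpectation b,
   and dAST makes the least one equal to b.

   dPAST: a bound through the worst-case runtime R alone is not enough, since R
   need not vanish along the scheduler that is good for d.  Resolve the
   nondeterminism for d instead: up to any eps > 0 the value awp C d s is attained
   by a finite nonnegative combination of point evaluations lying below
   awp C _ s.  These assemble into one positive linear operator T with
   d <= T d + eps, for which the usual optional stopping estimate gives
   d <= eps * R.

   Preservation: passing to an implementation shrinks awp and the runtime, and
   enlarges dwp, while implementations of the transformed program have the same
   awps. *)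
From mathcomp Require Import all_boot all_order all_algebra.
From mathcomp Require Import boolp classical_sets constructive_ereal reals ereal Rstruct.
From mathcomp Require Import ring lra.
Require Import Defs.
Set Implicit Arguments. Unset Strict Implicit. Unset Printing Implicit Defensive.
Import Order.TTheory GRing.Theory Num.Theory.
Local Open Scope ring_scope.
Local Open Scope ereal_scope.

Lemma exp_le_refl (f : Exp) : exp_le f f.
Proof. by move=> s. Qed.

Lemma exp_le_trans (f g h : Exp) : exp_le f g -> exp_le g h -> exp_le f h.
Proof. by move=> fg gh s; apply: le_trans (gh s). Qed.

(** * Least fixed points *)

Lemma lfp_le (Phi : Exp -> Exp) (g : Exp) :
  nonneg g -> exp_le (Phi g) g -> exp_le (lfp Phi) g.
Proof. by move=> g0 gP s; apply: ereal_inf_lbound; exists g. Qed.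

Lemma lfp_ge (Phi : Exp -> Exp) (s : States) (x : \bar R) :
  (forall g, nonneg g -> exp_le (Phi g) g -> x <= g s) -> x <= lfp Phi s.
Proof. by move=> H; apply: le_ereal_inf_tmp => _ [g [g0 gP] <-]; exact: H. Qed.

Lemma lfp_nonneg (Phi : Exp -> Exp) : nonneg (lfp Phi).
Proof. by move=> s; apply: lfp_ge => g g0 _; exact: g0. Qed.

Lemma lfp_mono (Phi Psi : Exp -> Exp) :
  (forall g, nonneg g -> exp_le (Phi g) (Psi g)) -> exp_le (lfp Phi) (lfp Psi).
Proof.
move=> H s; apply: lfp_ge => g g0 gP.
by apply: lfp_le => //; exact: exp_le_trans (H g g0) gP.
Qed.

(** [Exp] also contains maps with negative values; both clauses are confined to the nonnegative
    ones, the lattice in which [lfp] is formed. *)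
Definition monotone (T : Exp -> Exp) : Prop :=
  (forall f, nonneg f -> nonneg (T f)) /\
  (forall f g, nonneg f -> nonneg g -> exp_le f g -> exp_le (T f) (T g)).

Lemma lfp_prefix (Phi : Exp -> Exp) :
  monotone Phi -> exp_le (Phi (lfp Phi)) (lfp Phi).
Proof.
move=> [_ M] s; apply: lfp_ge => g g0 gP; apply: le_trans (gP s).
by apply: M => //; [exact: lfp_nonneg | exact: lfp_le].
Qed.

Lemma lfp_fix (Phi : Exp -> Exp) : monotone Phi -> Phi (lfp Phi) = lfp Phi.
Proof.
move=> MP; have [P0 M] := MP; apply/funext => s; apply/le_anti.
rewrite lfp_prefix //=; have L0 := @lfp_nonneg Phi.
apply: lfp_le; first exact: P0.
by apply: M => //; [exact: P0 | exact: lfp_prefix].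
Qed.

Lemma loopFE phi f body g s :
  loopF phi f body g s = if phi s then body g s else f s.
Proof.
by rewrite /loopF /iv; case: (phi s) => /=; rewrite !(mul0e, mul1e, add0e, adde0).
Qed.

Lemma loopF_monotone phi f body :
  nonneg f -> monotone body -> monotone (loopF phi f body).
Proof.
move=> f0 [b0 bM]; split=> [g g0 s|g h g0 h0 gh s]; rewrite !loopFE.
  by case: ifP => _; [exact: b0 | exact: f0].
by case: ifP => // _; exact: bM.
Qed.

Lemma lfp_loopE phi f body :
  nonneg f -> monotone body ->
  forall s, lfp (loopF phi f body) s =
    if phi s then body (lfp (loopF phi f body)) s else f s.
Proof.
by move=> f0 Mb s; rewrite -{1}(lfp_fix (loopF_monotone phi f0 Mb)) loopFE.
Qed.

Lemma lfp_loop_mono phi f g body body' :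
  exp_le f g -> (forall h, nonneg h -> exp_le (body h) (body' h)) ->
  exp_le (lfp (loopF phi f body)) (lfp (loopF phi g body')).
Proof.
move=> fg bb; apply: lfp_mono => h h0 s; rewrite !loopFE.
by case: ifP => _; [exact: bb | exact: fg].
Qed.

(** * Monotonicity of the transformers *)

Lemma prob_ge0 (p : R) : (0 <= p <= 1)%R -> (0 <= p)%R /\ (0 <= 1 - p)%R.
Proof. by move=> /andP[p0 p1]; split; rewrite // subr_ge0. Qed.

Lemma iv_ge0 b : 0 <= iv b.
Proof. by case: b; rewrite /iv. Qed.

Lemma iv_le1 b x : 0 <= x -> iv b * x <= x.
Proof. by case: b; rewrite /iv ?mul1e ?mul0e. Qed.

Lemma pconv_ge0 (p : R) (x y : \bar R) :
  (0 <= p <= 1)%R -> 0 <= x -> 0 <= y -> 0 <= p%:E * x + (1 - p)%:E * y.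
Proof. by move=> /prob_ge0[p0 q0] x0 y0; rewrite adde_ge0 ?mule_ge0 ?lee_fin. Qed.

Lemma pconv_le (p : R) (x x' y y' : \bar R) :
  (0 <= p <= 1)%R -> x <= x' -> y <= y' ->
  p%:E * x + (1 - p)%:E * y <= p%:E * x' + (1 - p)%:E * y'.
Proof. by move=> /prob_ge0[p0 q0] x0 y0; rewrite leeD ?lee_wpmul2l ?lee_fin. Qed.

Lemma pconv_cst (p c : R) : p%:E * c%:E + (1 - p)%:E * c%:E = c%:E.
Proof. by rewrite -!EFinM -EFinD; congr EFin; ring. Qed.

Lemma max_le (a b c d : \bar R) : a <= c -> b <= d -> maxe a b <= maxe c d.
Proof. by move=> ac bd; rewrite ge_max !le_max ac bd orbT. Qed.

Lemma le_maxl (a b : \bar R) : a <= maxe a b.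
Proof. by rewrite le_max lexx. Qed.

Lemma le_maxr (a b : \bar R) : b <= maxe a b.
Proof. by rewrite le_max lexx orbT. Qed.

Lemma min_le (a b c d : \bar R) : a <= c -> b <= d -> mine a b <= mine c d.
Proof. by move=> ac bd; rewrite le_min !ge_min ac bd orbT. Qed.

Lemma subst_monotone x E : monotone (fun f => subst f x E).
Proof. by split=> [f f0|f g f0 g0 fg] s; [exact: f0 | exact: fg]. Qed.

Lemma angelic_monotone phi1 phi2 T1 T2 : monotone T1 -> monotone T2 ->
  monotone (fun f s => maxe (iv (phi1 s) * T1 f s) (iv (phi2 s) * T2 f s)).
Proof.
move=> [n1 m1] [n2 m2]; split=> [f f0|f g f0 g0 fg] s.
  by rewrite le_max mule_ge0 ?iv_ge0 ?n1.
by apply: max_le; rewrite lee_wpmul2l ?iv_ge0 ?m1 ?m2.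
Qed.

Lemma pchoice_monotone p T1 T2 : (forall s, (0 <= p s <= 1)%R) ->
  monotone T1 -> monotone T2 ->
  monotone (fun f s => (p s)%:E * T1 f s + (1 - p s)%:E * T2 f s).
Proof.
move=> hp [n1 m1] [n2 m2]; split=> [f f0|f g f0 g0 fg] s.
  by apply: pconv_ge0; [exact: hp | exact: n1 | exact: n2].
by apply: pconv_le; [exact: hp | exact: m1 | exact: m2].
Qed.

Lemma demonic_monotone phi1 phi2 T1 T2 : monotone T1 -> monotone T2 ->
  monotone (fun f s => mine (guardE phi1 (T1 f) s) (guardE phi2 (T2 f) s)).
Proof.
move=> [n1 m1] [n2 m2]; split=> [f f0|f g f0 g0 fg] s; rewrite /guardE.
  by rewrite le_min; case: (phi1 s); case: (phi2 s); rewrite ?n1 ?n2 //= leey.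
by apply: min_le; case: ifP => // _; [exact: m1 | exact: m2].
Qed.

Lemma comp_monotone T1 T2 : monotone T1 -> monotone T2 ->
  monotone (fun f => T1 (T2 f)).
Proof.
move=> [n1 m1] [n2 m2]; split=> [f f0|f g f0 g0 fg].
  by apply: n1; exact: n2.
by apply: m1; [exact: n2 | exact: n2 | exact: m2].
Qed.

Lemma cstD_monotone T : monotone T -> monotone (fun f s => 1 + T f s).
Proof.
move=> [n m]; split=> [f f0|f g f0 g0 fg] s; first by rewrite adde_ge0 ?n.
by rewrite leeD2l // m.
Qed.

Lemma awp_monotone C : monotone (awp C).
Proof.
elim: C => [|x E|C1 M1 C2 M2|phi1 phi2 h C1 M1 C2 M2|p hp C1 M1 C2 M2|phi C M I hI].
- by split.
- exact: subst_monotone.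
- exact: comp_monotone.
- exact: angelic_monotone.
- exact: pchoice_monotone.
- split=> [f f0|f g f0 g0 fg]; first exact: lfp_nonneg.
  by apply: lfp_loop_mono => // h h0.
Qed.

Lemma awps_monotone C : monotone (awps C).
Proof.
elim: C => [|x E|C1 M1 C2 M2|phi1 phi2 h C1 M1 C2 M2|p hp C1 M1 C2 M2|phi C M I hI].
- by split.
- exact: subst_monotone.
- exact: comp_monotone.
- exact: angelic_monotone.
- exact: pchoice_monotone.
- by split=> [f f0|f g f0 g0 fg] //=; exact: exp_le_refl.
Qed.

Lemma dwp_monotone C : monotone (dwp C).
Proof.
elim: C => [|x E|C1 M1 C2 M2|phi1 phi2 h C1 M1 C2 M2|p hp C1 M1 C2 M2|phi C M I hI].
- by split.
- exact: subst_monotone.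
- exact: comp_monotone.
- exact: demonic_monotone.
- exact: pchoice_monotone.
- split=> [f f0|f g f0 g0 fg]; first exact: lfp_nonneg.
  by apply: lfp_loop_mono => // h h0.
Qed.

Lemma ert_whileE phi C I hI t :
  ert (While phi C I hI) t = lfp (fun g s => 1 + loopF phi t (ert C) g s).
Proof. by []. Qed.

Lemma ert_monotone C : monotone (ert C).
Proof.
elim: C => [|x E|C1 M1 C2 M2|phi1 phi2 h C1 M1 C2 M2|p hp C1 M1 C2 M2|phi C M I hI].
- by apply: cstD_monotone; split.
- by apply: (@cstD_monotone (fun f => subst f x E)); exact: subst_monotone.
- exact: comp_monotone.
- by apply: cstD_monotone; exact: angelic_monotone.
- by apply: cstD_monotone; exact: pchoice_monotone.
- split=> [f f0|f g f0 g0 fg]; rewrite !ert_whileE; first exact: lfp_nonneg.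
  apply: lfp_mono => h h0 s; rewrite leeD2l // !loopFE.
  by case: ifP.
Qed.

Lemma awp_nonneg C f : nonneg f -> nonneg (awp C f).
Proof. exact: (proj1 (awp_monotone C)). Qed.

Lemma awp_le C f g : nonneg f -> nonneg g -> exp_le f g -> exp_le (awp C f) (awp C g).
Proof. exact: (proj2 (awp_monotone C)). Qed.

Lemma awps_nonneg C f : nonneg f -> nonneg (awps C f).
Proof. exact: (proj1 (awps_monotone C)). Qed.

Lemma dwp_nonneg C f : nonneg f -> nonneg (dwp C f).
Proof. exact: (proj1 (dwp_monotone C)). Qed.

Lemma dwp_le C f g : nonneg f -> nonneg g -> exp_le f g -> exp_le (dwp C f) (dwp C g).
Proof. exact: (proj2 (dwp_monotone C)). Qed.

Lemma ert_nonneg C f : nonneg f -> nonneg (ert C f).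
Proof. exact: (proj1 (ert_monotone C)). Qed.

Lemma ert_le C f g : nonneg f -> nonneg g -> exp_le f g -> exp_le (ert C f) (ert C g).
Proof. exact: (proj2 (ert_monotone C)). Qed.

(** * Healthiness conditions *)

(** A constant is a prefixed point of every loop. Equality can fail because diverging runs
    contribute 0. *)
Lemma awp_cst C (c : R) : (0 <= c)%R -> exp_le (awp C (fun=> c%:E)) (fun=> c%:E).
Proof.
move=> c0; have n0 : nonneg (fun=> c%:E) by move=> s; rewrite lee_fin.
elim: C => [|x E|C1 M1 C2 M2
    |phi1 phi2 h C1 M1 C2 M2|p hp C1 M1 C2 M2|phi C M I hI] s /=.
- exact: lexx.
- exact: lexx.
- apply: le_trans (M1 s); apply: awp_le => //; exact: awp_nonneg.
- rewrite ge_max; apply/andP; split.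
  + by apply: le_trans (M1 s); apply: iv_le1; exact: awp_nonneg.
  + by apply: le_trans (M2 s); apply: iv_le1; exact: awp_nonneg.
- by rewrite -[leRHS](pconv_cst (p s)); apply: pconv_le; [exact: hp| |].
- apply: lfp_le => // t; rewrite loopFE.
  by case: ifP.
Qed.

(** A maximum of sums is at most the sum of the maxima; for a loop, the sum of the two least fixed
    points is a prefixed point for [f \+ g]. *)
Lemma awp_subadditive C f g : nonneg f -> nonneg g ->
  exp_le (awp C (f \+ g)) (awp C f \+ awp C g).
Proof.
elim: C f g => [|x E|C1 M1 C2 M2
    |phi1 phi2 h C1 M1 C2 M2|p hp C1 M1 C2 M2|phi C M I hI] f g f0 g0 s /=.
- exact: lexx.
- exact: lexx.
- have nn k1 k2 : nonneg k1 -> nonneg k2 -> nonneg (k1 \+ k2).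
    by move=> *; move=> t /=; exact: adde_ge0.
  apply: le_trans (M1 _ _ (awp_nonneg C2 f0) (awp_nonneg C2 g0) s).
  apply: awp_le; [exact/awp_nonneg/nn | by apply: nn; exact: awp_nonneg | exact: M2].
- rewrite /= ge_max; apply/andP; split.
  + apply: (le_trans _ (leeD (le_maxl _ _) (le_maxl _ _))).
    rewrite -ge0_muleDr ?awp_nonneg //; apply: lee_wpmul2l; [exact: iv_ge0|exact: M1].
  + apply: (le_trans _ (leeD (le_maxr _ _) (le_maxr _ _))).
    rewrite -ge0_muleDr ?awp_nonneg //; apply: lee_wpmul2l; [exact: iv_ge0|exact: M2].
- rewrite addeACA -!ge0_muleDr ?awp_nonneg //.
  by apply: pconv_le; [exact: hp | exact: M1 | exact: M2].
- set A := lfp (loopF phi f _); set B := lfp (loopF phi g _).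
  have A0 : nonneg A by exact: lfp_nonneg.
  have B0 : nonneg B by exact: lfp_nonneg.
  have Ap := lfp_loopE phi f0 (awp_monotone C).
  have Bp := lfp_loopE phi g0 (awp_monotone C).
  apply: (@lfp_le _ (A \+ B)) => [t|t] /=; first exact: adde_ge0.
  rewrite loopFE /A /B Ap Bp; case: ifP => // _.
  exact: M.
Qed.

(** Serves to pass from [dwp C one] to other constants. Strict positivity of r preserves the value
    oo of a disabled branch. *)
Lemma dwp_scale C (r : R) f : (0 < r)%R -> nonneg f ->
  exp_le (dwp C (fun s => r%:E * f s)) (fun s => r%:E * dwp C f s).
Proof.
move=> r0; have r0E : 0 <= r%:E by rewrite lee_fin ltW.
have nn k : nonneg k -> nonneg (fun s => r%:E * k s).
  by move=> k0 t; rewrite mule_ge0.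
elim: C f => [|x E|C1 M1 C2 M2
    |phi1 phi2 h C1 M1 C2 M2|p hp C1 M1 C2 M2|phi C M I hI] f f0 s /=.
- exact: lexx.
- exact: lexx.
- apply: le_trans (M1 _ (dwp_nonneg C2 f0) s).
  by apply: dwp_le; [exact/dwp_nonneg/nn | exact/nn/dwp_nonneg | exact: M2].
- rewrite mine_pMr //; apply: min_le; rewrite /guardE.
    by case: ifP => _; [exact: M1 | rewrite gt0_muley ?lte_fin].
  by case: ifP => _; [exact: M2 | rewrite gt0_muley ?lte_fin].
- rewrite ge0_muleDr ?mule_ge0 ?dwp_nonneg ?lee_fin //; try by case: (prob_ge0 (hp s)).
  rewrite !muleA ![r%:E * _]muleC -!muleA.
  by apply: pconv_le; [exact: hp | exact: M1 | exact: M2].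
- set L := lfp (loopF phi f _).
  have L0 : nonneg L by exact: lfp_nonneg.
  have Lp := lfp_loopE phi f0 (dwp_monotone C).
  apply: (@lfp_le _ (fun s => r%:E * L s)) => [t|t] /=; first exact: mule_ge0.
  rewrite loopFE /L Lp; case: ifP => // _.
  exact: M.
Qed.

(* The loop case rests on a duality: if L is the angelic value of d, then
   c - L is a prefixed point of the demonic loop with postexpectation e. *)
Lemma awp_dwp_le C (c : R) d e : nonneg d -> nonneg e ->
  (forall s, d s + e s <= c%:E) -> forall s, awp C d s + dwp C e s <= c%:E.
Proof.
elim: C d e => [|x E|C1 M1 C2 M2
    |phi1 phi2 h C1 M1 C2 M2|p hp C1 M1 C2 M2|phi C M I hI] d e d0 e0 dec s /=.
- exact: dec.
- exact: dec.
- apply: M1 => [||t]; [exact: awp_nonneg | exact: dwp_nonneg | exact: M2].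
- have := M1 d e d0 e0 dec s; have := M2 d e d0 e0 dec s.
  have := h s; rewrite /guardE /iv.
  have a1 := awp_nonneg C1 d0 s; have a2 := awp_nonneg C2 d0 s.
  case: (phi1 s) => /=; case: (phi2 s) => //= _ h2 h1; rewrite ?mul1e ?mul0e.
  (* The maximum equals one of the two angelic values, and the minimum is at most the demonic value
     of that same branch. *)
  + rewrite /maxe; case: ifP => _.
      by apply: le_trans h2; rewrite leeD2l // ge_min lexx orbT.
    by apply: le_trans h1; rewrite leeD2l // ge_min lexx.
  + by rewrite max_l // min_l ?leey.
  + by rewrite max_r // min_r ?leey.
- rewrite addeACA -!ge0_muleDr ?awp_nonneg ?dwp_nonneg //.
  rewrite -[leRHS](pconv_cst (p s)).
  by apply: pconv_le; [exact: hp | exact: M1 | exact: M2].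
- set A := lfp (loopF phi d _).
  have A0 : nonneg A by exact: lfp_nonneg.
  have Ap := lfp_loopE phi d0 (awp_monotone C).
  have dc t : d t <= c%:E by apply: le_trans (dec t); rewrite leeDl.
  have c0 : (0 <= c)%R by rewrite -lee_fin; apply: le_trans (dc s).
  have Ac t : A t <= c%:E.
    have := @awp_cst (While phi C I hI) c c0 t; apply: le_trans.
    exact: (@awp_le (While phi C I hI)).
  have Af t : A t \is a fin_num.
    by rewrite ge0_fin_numE //; exact: le_lt_trans (Ac t) (ltry c).
  pose x t := c%:E - A t.
  have x0 : nonneg x by move=> t; rewrite sube_ge0 ?Af.
  have Dx : exp_le (lfp (loopF phi e (dwp C))) x.
    apply: lfp_le => // t; rewrite loopFE /x leeBrDr // addeC {1}/A Ap.
    case: ifP => _; last exact: dec.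
    by apply: M => // u; rewrite /x addeC subeK.
  by rewrite addeC -leeBrDr //; exact: Dx.
Qed.

Lemma awp_whileE phi C I hI f s : nonneg f ->
  awp (While phi C I hI) f s =
  if phi s then awp C (awp (While phi C I hI) f) s else f s.
Proof. by move=> f0; rewrite /= {1}lfp_loopE //; exact: awp_monotone. Qed.

(** * Approximation by finitely supported functionals *)

Definition wsum (l : seq (R * States)) (g : Exp) : \bar R :=
  \sum_(x <- l) x.1%:E * g x.2.

Definition wpos (l : seq (R * States)) : bool := all (fun x => 0 <= x.1)%R l.

(** The bound holds for all nonnegative arguments at once, so a list chosen for one function can
    later be applied to others. *)
Definition minorant (T : Exp -> Exp) (s : States) : set (seq (R * States)) :=
  [set l | wpos l /\ forall g, nonneg g -> wsum l g <= T g s].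

Definition approx (T : Exp -> Exp) (f : Exp) : Exp :=
  fun s => ereal_sup [set wsum l f | l in minorant T s].

Definition approximable (T : Exp -> Exp) : Prop :=
  forall f, nonneg f -> exp_le (T f) (approx T f).

Lemma wsum_nil g : wsum [::] g = 0.
Proof. by rewrite /wsum big_nil. Qed.

Lemma wsum_cons x l g : wsum (x :: l) g = x.1%:E * g x.2 + wsum l g.
Proof. by rewrite /wsum big_cons. Qed.

Lemma wsum_ge0 l g : wpos l -> nonneg g -> 0 <= wsum l g.
Proof.
move=> + g0; elim: l => [|x l IH] /=; first by rewrite wsum_nil.
by move=> /andP[x0 /IH l0]; rewrite wsum_cons adde_ge0 ?mule_ge0 ?lee_fin.
Qed.

Definition wscale (w : R) (l : seq (R * States)) : seq (R * States) :=
  [seq ((w * x.1)%R, x.2) | x <- l].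

Lemma wpos_scale_cat w v l m : (0 <= w)%R -> (0 <= v)%R -> wpos l -> wpos m ->
  wpos (wscale w l ++ wscale v m).
Proof.
move=> w0 v0 l0 m0; rewrite /wpos all_cat !all_map.
by apply/andP; split; [move: l0 | move: m0]; apply: sub_all => x x0; exact: mulr_ge0.
Qed.

Lemma wsum_scale w l g : (0 <= w)%R -> wpos l -> nonneg g ->
  wsum (wscale w l) g = w%:E * wsum l g.
Proof.
move=> w0 + g0; elim: l => [|x l IH] /=; first by rewrite !wsum_nil mule0.
move=> /andP[x0 l0]; rewrite !wsum_cons IH // ge0_muleDr ?wsum_ge0 //.
  by rewrite EFinM muleA.
by rewrite mule_ge0 ?lee_fin.
Qed.

Lemma wsum_scale_cat w v l m g :
  (0 <= w)%R -> (0 <= v)%R -> wpos l -> wpos m -> nonneg g ->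
  wsum (wscale w l ++ wscale v m) g = w%:E * wsum l g + v%:E * wsum m g.
Proof. by move=> *; rewrite -!wsum_scale // /wsum big_cat. Qed.

(** One supremum is absorbed at a time. Membership of 0 excludes empty sets and settles the case
    where the other summand is infinite. *)
Lemma ereal_sup_lincomb_le (p q : R) (A B : set (\bar R)) (h : \bar R) :
  (0 <= p)%R -> (0 <= q)%R -> A 0 -> B 0 -> (forall y, B y -> 0 <= y) ->
  (forall x y, A x -> B y -> p%:E * x + q%:E * y <= h) ->
  p%:E * ereal_sup A + q%:E * ereal_sup B <= h.
Proof.
have aux (r : R) X c : (0 <= r)%R -> X 0 -> 0 <= c ->
    (forall x, X x -> r%:E * x + c <= h) -> r%:E * ereal_sup X + c <= h.
  move=> r0 X0; case: c => [c||] // c0 H.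
  - rewrite -leeBrDr // -ereal_supZl //; last by apply/set0P; exists 0.
    by apply: ge_ereal_sup => _ [x Xx <-]; rewrite leeBrDr //; exact: H.
  - by have := H 0 X0; rewrite mule0 add0e leye_eq => /eqP ->; rewrite leey.
move=> p0 q0 A0 B0 Bp H.
have sB : 0 <= ereal_sup B by exact: ereal_sup_ubound.
apply: (aux) => //; first by rewrite mule_ge0 ?lee_fin.
move=> x Ax; rewrite addeC; case: (leP 0 x) => x0.
  apply: (aux) => //; first by rewrite mule_ge0 ?lee_fin.
  by move=> y By; rewrite addeC; exact: H.
(* A negative x is replaced by 0, which also lies in A. *)
apply: (@le_trans _ _ (q%:E * ereal_sup B + 0)).
  by rewrite leeD2l // mule_ge0_le0 ?lee_fin // ltW.
by apply: (aux) => // y By; rewrite addeC -(mule0 p%:E); exact: H.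
Qed.

Lemma minorant_nil T s : monotone T -> minorant T s [::].
Proof. by move=> [n _]; split=> // g g0; rewrite wsum_nil n. Qed.

Lemma approx_ge0 T f : monotone T -> nonneg (approx T f).
Proof.
move=> MT s; apply: ereal_sup_ubound; exists [::]; last exact: wsum_nil.
exact: minorant_nil.
Qed.

Lemma approx_ub T f s l : minorant T s l -> wsum l f <= approx T f s.
Proof. by move=> lT; apply: ereal_sup_ubound; exists l. Qed.

Lemma approx_le T T' f s s' :
  (forall l, minorant T s l -> minorant T' s' l) ->
  approx T f s <= approx T' f s'.
Proof. by move=> H; apply: ge_ereal_sup => _ [l /H lT <-]; exact: approx_ub. Qed.

(* Each point of the support of l can be given its own almost optimal minorant
   of T; finiteness of the support makes this a finite composition. *)
Lemma wsum_approx T l f : monotone T -> wpos l -> nonneg f ->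
  wsum l (approx T f) <=
  ereal_sup [set wsum m f | m in
    [set m | wpos m /\ forall g, nonneg g -> wsum m g <= wsum l (T g)]].
Proof.
move=> MT + f0; elim: l => [|[w t] l IH] /=.
  move=> _; rewrite wsum_nil; apply: ereal_sup_ubound.
  by exists [::]; [split=> // g _; rewrite !wsum_nil | rewrite wsum_nil].
move=> /andP[w0 l0]; rewrite wsum_cons /=.
apply: le_trans (leeD2l _ (IH l0)) _.
rewrite -[X in _ + X]mul1e; apply: ereal_sup_lincomb_le => //.
- by exists [::]; [exact: minorant_nil | exact: wsum_nil].
- exists [::]; last exact: wsum_nil.
  by split=> // g g0; rewrite wsum_nil wsum_ge0 //; exact: (proj1 MT).
- by move=> _ [m [m0 _] <-]; exact: wsum_ge0.
move=> _ _ [m [m0 mT] <-] [k [k0 kT] <-]; apply: ereal_sup_ubound.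
exists (wscale w m ++ wscale 1%R k); last by rewrite wsum_scale_cat.
split; first exact: wpos_scale_cat.
move=> g g0; rewrite wsum_scale_cat // wsum_cons mul1e.
by rewrite leeD ?kT // lee_wpmul2l ?lee_fin ?mT.
Qed.

(** A minorant l of T1 at s handles the outer operator; [wsum_approx] then pushes the approximation
    of T2 through the finitely many points of l. *)
Lemma approx_comp T1 T2 f s :
  monotone T1 -> monotone T2 -> approximable T1 -> nonneg f ->
  T1 (approx T2 f) s <= approx (fun g => T1 (T2 g)) f s.
Proof.
move=> M1 M2 A1 f0; apply: le_trans (A1 _ (approx_ge0 f M2) s) _.
apply: ge_ereal_sup => _ [l [l0 lT] <-]; apply: le_trans (wsum_approx M2 l0 f0) _.
apply: ge_ereal_sup => _ [m [m0 mT] <-]; apply: approx_ub.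
split=> // g g0; apply: le_trans (mT g g0) _; apply: lT; exact: (proj1 M2).
Qed.

(** In the loop case the approximation of the loop is itself a prefixed point: where the guard
    holds, a minorant of the body composed with the loop is, by unfolding once, a minorant of the
    loop. *)
Lemma awp_approximable C : approximable (awp C).
Proof.
elim: C => [|x E|C1 A1 C2 A2
    |phi1 phi2 h C1 A1 C2 A2|p hp C1 A1 C2 A2|phi C AC I hI] f f0 s.
- have -> : awp Skip f s = wsum [:: (1%R, s)] f.
    by rewrite wsum_cons wsum_nil mul1e adde0.
  apply: approx_ub; split=> [|g g0]; first by rewrite /= ler01.
  by rewrite wsum_cons wsum_nil mul1e adde0.
- have -> : awp (Assign x E) f s = wsum [:: (1%R, upd s x (E s))] f.
    by rewrite wsum_cons wsum_nil mul1e adde0.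
  apply: approx_ub; split=> [|g g0]; first by rewrite /= ler01.
  by rewrite wsum_cons wsum_nil mul1e adde0.
- have M1 := awp_monotone C1; have M2 := awp_monotone C2.
  apply: le_trans (approx_comp s M1 M2 A1 f0); apply: awp_le; last exact: A2.
    exact: awp_nonneg.
  exact: approx_ge0.
- have Z := approx_ge0 f (awp_monotone (GChoice phi1 phi2 h C1 C2)) s.
  rewrite [awp _]/= ge_max; apply/andP; split.
  + case E : (phi1 s); rewrite /iv ?mul0e // mul1e.
    apply: le_trans (A1 f f0 s) _; apply: approx_le => l [l0 lT]; split=> // g g0.
    by apply: le_trans (lT g g0) _; rewrite /= E mul1e le_maxl.
  + case E : (phi2 s); rewrite /iv ?mul0e // mul1e.
    apply: le_trans (A2 f f0 s) _; apply: approx_le => l [l0 lT]; split=> // g g0.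
    by apply: le_trans (lT g g0) _; rewrite /= E mul1e le_maxr.
- have [p0 q0] := prob_ge0 (hp s).
  apply: le_trans (pconv_le (hp s) (A1 f f0 s) (A2 f f0 s)) _.
  apply: ereal_sup_lincomb_le => //.
  + by exists [::]; [apply: minorant_nil; exact: awp_monotone | exact: wsum_nil].
  + by exists [::]; [apply: minorant_nil; exact: awp_monotone | exact: wsum_nil].
  + by move=> _ [m [m0 _] <-]; exact: wsum_ge0.
  move=> _ _ [m [m0 mT] <-] [k [k0 kT] <-]; rewrite -wsum_scale_cat //.
  apply: approx_ub; split; first exact: wpos_scale_cat.
  move=> g g0; rewrite wsum_scale_cat //.
  by apply: pconv_le; [exact: hp | exact: mT | exact: kT].
- set W := While phi C I hI; have MW := awp_monotone W; have MC := awp_monotone C.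
  apply: lfp_le; first exact: approx_ge0.
  move=> t; rewrite loopFE; case: ifP => pt.
    apply: le_trans (approx_comp t MC MW AC f0) _.
    apply: approx_le => l [l0 lT]; split=> // g g0.
    by rewrite awp_whileE // pt; exact: lT.
  have -> : f t = wsum [:: (1%R, t)] f by rewrite wsum_cons wsum_nil mul1e adde0.
  apply: approx_ub; split=> [|g g0]; first by rewrite /= ler01.
  by rewrite wsum_cons wsum_nil mul1e adde0 awp_whileE // pt.
Qed.

(** * Optional stopping for positive linear operators *)

Section OptionalStopping.
Local Open Scope ring_scope.
(** T models one loop iteration after the nondeterminism is resolved. It acts on signed real
    functions, so differences may be formed. *)
Variables (S : Type) (T : (S -> R) -> S -> R).
Hypothesis T_le : forall g h, (forall s, g s <= h s) -> forall s, T g s <= T h s.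
Hypothesis T_lin : forall a g h s,
  T (fun t => a * g t + h t) s = a * T g s + T h s.
Hypothesis T_one : forall s, T (fun=> 1) s <= 1.

Let T_zero s : T (fun=> 0) s = 0.
Proof.
have := T_lin 1 (fun=> 0) (fun=> 0) s.
by under [X in T X]funext => t do rewrite mulr0 addr0; lra.
Qed.

(** The n-th iterate of T on 1: the probability that the loop is still running after n
    iterations. *)
Fixpoint survival (n : nat) : S -> R :=
  if n is m.+1 then T (survival m) else fun=> 1.

(** The sum of [survival k] over k < n: the expected number of iterations, cut off at n. *)
Fixpoint steps (n : nat) : S -> R :=
  if n is m.+1 then fun s => 1 + T (steps m) s else fun=> 0.

Let survival_ge0 n s : 0 <= survival n s.
Proof.
elim: n s => [|n IH] s //=.
by rewrite -(T_zero s); exact: T_le.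
Qed.

Let survival_le1 n s : survival n s <= 1.
Proof.
elim: n s => [|n IH] s //=.
by apply: le_trans (T_one s); exact: T_le.
Qed.

(** Survival decreases with n, so each of the n summands of [steps n] is at least [survival n]. *)
Let survival_steps n s : n%:R * survival n s <= steps n s.
Proof.
elim: n s => [|n IH] s; first by rewrite mul0r.
have := @T_le (fun t => n%:R * survival n t + 0) (steps n) _ s.
rewrite T_lin T_zero /= => H.
have {}H : n%:R * T (survival n) s + 0 <= T (steps n) s.
  by apply: H => t; rewrite addr0.
have := survival_le1 n.+1 s; rewrite /= => H1.
by rewrite -natr1; lra.
Qed.

Let steps_le (r : S -> R) : (forall s, 0 <= r s) -> (forall s, 1 + T r s <= r s) ->
  forall n s, steps n s <= r s.
Proof.
move=> r0 rT; elim=> [|n IH] s //=.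
by apply: le_trans (rT s); rewrite lerD2l; exact: T_le.
Qed.

Variables (d I : S -> R) (b eps : R).
Hypothesis eps0 : 0 <= eps.
Hypothesis b0 : 0 < b.
Hypothesis d0 : forall s, 0 <= d s.
Hypothesis dI : forall s, d s <= I s.
Hypothesis dT : forall s, d s <= T d s + eps.
Hypothesis I_diff : forall s, T (fun t => `|I t - I s|) s <= b.

(** Unrolls [dT] n times: surviving runs still carry I, and every iteration costs at most b for the
    drift of I and eps for the loss. *)
Let d_steps n s : d s <= I s * survival n s + (b + eps) * steps n s.
Proof.
elim: n s => [|n IH] s /=; first by rewrite mulr1 mulr0 addr0.
apply: le_trans (dT s) _; apply: le_trans (lerD (T_le IH s) (lexx _)) _.
have -> : (fun t => I t * survival n t + (b + eps) * steps n t) =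
    (fun t => (b + eps) * steps n t + I t * survival n t).
  by apply/funext => t; rewrite addrC.
rewrite T_lin.
(* Survival weights lie between 0 and 1, so replacing I t by I s costs at most |I t - I s|. *)
have H : T (fun t => I t * survival n t) s <=
    T (fun t => I s * survival n t + `|I t - I s|) s.
  apply: T_le => t; have a0 := survival_ge0 n t; have a1 := survival_le1 n t.
  have h1 := ler_norm (I t - I s); have h2 := normr_ge0 (I t - I s).
  nra.
rewrite T_lin in H; have := I_diff s; lra.
Qed.

(** If d s exceeded the bound by x > 0, then x <= I s * survival n s for all n; multiplied by n this
    gives n * x <= I s * r s, false for large n. *)
Let d_runtime (r : S -> R) : (forall s, 0 <= r s) -> (forall s, 1 + T r s <= r s) ->
  forall s, d s <= (b + eps) * r s.
Proof.
move=> r0 rT s; rewrite leNgt; apply/negP => lt_d.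
set x := d s - (b + eps) * r s; have x0 : 0 < x by rewrite subr_gt0.
have I0 : 0 <= I s by apply: le_trans (dI s).
have := archi_boundP (divr_ge0 (mulr_ge0 I0 (r0 s)) (ltW x0)).
set n := Num.bound _; rewrite ltr_pdivrMr // => lt_n.
have st := steps_le r0 rT n s; have dn := d_steps n s; have sn := survival_steps n s.
have xa : x <= I s * survival n s.
  have : (b + eps) * steps n s <= (b + eps) * r s.
    by rewrite ler_wpM2l // addr_ge0 // ltW.
  rewrite /x; lra.
have : n%:R * x <= I s * r s.
  apply: (@le_trans _ _ (n%:R * (I s * survival n s))).
    by rewrite ler_wpM2l.
  rewrite mulrCA ler_wpM2l //; exact: le_trans sn st.
by move: lt_n; lra.
Qed.

(* T has a least function r with 1 + T r <= r: the exact runtime.  By linearity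
   the part of d exceeding eps * r, scaled by 1 / b, could be subtracted from r,
   so it vanishes. *)
Lemma optional_stopping (r : S -> R) :
  (forall s, 0 <= r s) -> (forall s, 1 + T r s <= r s) ->
  forall s, d s <= eps * r s.
Proof.
move=> r0 rT.
(* The pointwise infimum m of all solutions q of [1 + T q <= q] is again a solution because T is
   monotone. *)
pose P s := [set x | exists q : S -> R,
  [/\ forall s, 0 <= q s, forall s, 1 + T q s <= q s & x = q s]]%classic.
have Plb s : has_lbound (P s) by exists 0 => _ [q [q0 _ ->]].
pose m s := inf (P s).
have mle q : (forall s, 0 <= q s) -> (forall s, 1 + T q s <= q s) ->
    forall s, m s <= q s.
  by move=> q0 qT s; apply: ge_inf => //; exists q.
have mge s x : (forall q, (forall s, 0 <= q s) -> (forall s, 1 + T q s <= q s) ->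
    x <= q s) -> x <= m s.
  move=> H; apply: lb_le_inf; first by exists (r s); exists r.
  by move=> _ [q [q0 qT ->]]; exact: H.
have m0 s : 0 <= m s by apply: mge.
have mT s : 1 + T m s <= m s.
  by apply: mge => q q0 qT; apply: le_trans (qT s); rewrite lerD2l; exact/T_le/mle.
have dm := d_runtime m0 mT.
pose e s := Num.max 0 (d s - eps * m s).
have e0 s : 0 <= e s by rewrite le_max lexx.
have ege s : d s - eps * m s <= e s by rewrite le_max lexx orbT.
have ele s : e s <= b * m s.
  rewrite ge_max; apply/andP; split; first by rewrite mulr_ge0 // ltW.
  by have := dm s; lra.
have eT s : e s <= T e s.
  rewrite ge_max; apply/andP; split.
    by rewrite -(T_zero s); exact: T_le.
  (* The eps lost in [dT] is offset by eps times the 1 in [mT]. *)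
  have H : T (fun t => - eps * m t + d t) s <= T e s.
    by apply: T_le => t; have := ege t; lra.
  rewrite T_lin in H; have := dT s; have := ler_wpM2l eps0 (mT s).
  lra.
pose q s := - b^-1 * e s + m s.
have bV : 0 < b^-1 by rewrite invr_gt0.
have q0 s : 0 <= q s.
  rewrite /q mulNr addrC subr_ge0 mulrC ler_pdivrMr // mulrC; exact: ele.
have qT s : 1 + T q s <= q s.
  rewrite /q T_lin; have := mT s; have := ler_wpM2l (ltW bV) (eT s); lra.
move=> s; have := mle q q0 qT s; rewrite /q => H.
have e_le0 : b^-1 * e s <= 0 by lra.
rewrite pmulr_rle0 // in e_le0.
have dme : d s <= eps * m s by have := ege s; lra.
by apply: le_trans dme _; rewrite ler_wpM2l // mle.
Qed.

End OptionalStopping.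

(** * Lower bounds for loops *)

(** Subtracting oo always yields -oo, so the excess is 0 wherever g is oo. *)
Definition excess (f g : Exp) : Exp := fun s => maxe 0 (f s - g s).

Lemma excess_ge0 f g : nonneg (excess f g).
Proof. by move=> s; rewrite le_maxl. Qed.

Lemma excess_le f g : nonneg f -> nonneg g -> exp_le (excess f g) f.
Proof.
by move=> f0 g0 s; rewrite ge_max f0 /= -[leRHS]sube0 leeB.
Qed.

Lemma le_excess f g : nonneg f -> nonneg g -> exp_le f (g \+ excess f g).
Proof.
move=> f0 g0 s /=.
have H : f s - g s <= excess f g s by exact: le_maxr.
move: (excess f g s) (excess_ge0 f g s) H => e e0.
have := g0 s; case: (g s) => [y||] // _; first by rewrite leeBlDl.
by move=> _; rewrite addye ?leey // gt_eqF // (lt_le_trans _ e0) ?ltNy0.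
Qed.

Section Loop.
Variables (phi : Pred) (C : Prog) (I : Exp) (hI : nonneg I) (f : Exp).
Hypothesis f0 : nonneg f.
Hypothesis I_sub : exp_le I (loopF phi f (awp C) I).

Let W := While phi C I hI.
Let d := excess I (awp W f).
Let L0 : nonneg (awp W f). Proof. exact: awp_nonneg. Qed.

(** With L the value of the loop, I <= awp C (L + d) <= L + awp C d where the guard holds; elsewhere
    I <= f = L, so d vanishes. *)
Lemma excess_subinv s : d s <= iv (phi s) * awp C d s.
Proof.
have d0 : nonneg d by exact: excess_ge0.
rewrite ge_max mule_ge0 ?iv_ge0 ?awp_nonneg // andTb.
have Is := I_sub s; rewrite loopFE in Is; have := awp_whileE phi C hI s f0.
rewrite -/W; case: (phi s) Is => Is Ws; rewrite /iv ?mul1e ?mul0e.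
  have : I s <= awp W f s + awp C d s.
    apply: le_trans Is _; rewrite Ws.
    apply: le_trans (awp_subadditive C L0 d0 s).
    apply: awp_le; [exact: hI | | exact: le_excess].
    by move=> t; apply: adde_ge0; [exact: L0 | exact: d0].
  have := L0 s; case: (awp W f s) => [y||] // _; first by rewrite leeBlDl.
  by move=> _; rewrite addeNy leNye.
have : I s <= awp W f s by rewrite Ws.
have := L0 s; case: (awp W f s) => [y||] // _; first by rewrite leeBlDl ?adde0.
by move=> _; rewrite addeNy leNye.
Qed.

Lemma excess_eq0 : (forall s, d s <= 0) -> exp_le I (awp W f).
Proof.
move=> H s; apply: le_trans (le_excess hI L0 s) _ => /=.
by rewrite -[leRHS]adde0 leeD2l.
Qed.

Lemma dAST_lower_bound (b : R) :
  (0 <= b)%R -> bounded_by I b -> dAST W -> exp_le I (awp W f).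
Proof.
move=> b0 Ib Wd; apply: excess_eq0.
have d0 : nonneg d by exact: excess_ge0.
have dI := excess_le hI L0; rewrite -/d in dI.
(* One is added to make the constant positive, hence invertible. *)
pose c := (b + 1)%R; have c0 : (0 < c)%R by rewrite /c; lra.
have dc s : d s <= c%:E.
  by apply: le_trans (dI s) _; apply: le_trans (Ib s) _; rewrite lee_fin /c; lra.
have dfin s : d s \is a fin_num.
  by rewrite ge0_fin_numE //; exact: le_lt_trans (dc s) (ltry c).
pose x s := c%:E - d s.
have x0 : nonneg x by move=> s; rewrite sube_ge0 ?dfin.
have cst0 : nonneg (fun=> c%:E) by move=> s; rewrite lee_fin ltW.
(* The complement c - d is a prefixed point: the duality of [awp] and [dwp] covers the body, and d =
   0 outside the guard. *)
have Wx : exp_le (dwp W (fun=> c%:E)) x.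
  apply: lfp_le => // s; rewrite loopFE; have := excess_subinv s.
  rewrite -/d /x leeBrDr //; case: (phi s); rewrite /iv ?mul1e ?mul0e => ds.
    apply: le_trans (leeD2l _ ds) _; rewrite addeC.
    by apply: awp_dwp_le => // t; rewrite addeC subeK.
  by rewrite -[leRHS]adde0 leeD2l.
move=> s.
have Wc : c%:E <= dwp W (fun=> c%:E) s.
  have H := @dwp_scale W (c^-1)%R _ _ cst0 s.
  have E : (fun=> (c^-1)%:E * c%:E) = one.
    by apply/funext => t; rewrite -EFinM mulVf // gt_eqF.
  rewrite E Wd /one invr_gt0 in H.
  have := lee_wpmul2l (ltW c0 : 0 <= c%:E) (H c0).
  by rewrite mule1 muleA -EFinM mulfV ?mul1e // gt_eqF.
have := le_trans Wc (Wx s); rewrite /x leeBrDr //.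
by rewrite -[leRHS]adde0 leeD2lE.
Qed.

End Loop.

(** Both calculi take the maximum at a choice, and the runtime only adds ticks. This makes the
    runtime of a loop decrease under [awp] of its body. *)
Lemma awp_le_ert C t : nonneg t -> exp_le (awp C t) (ert C t).
Proof.
have D (x y : \bar R) : x <= y -> x <= 1 + y.
  by move=> xy; apply: le_trans xy _; rewrite leeDr.
elim: C t => [|x E|C1 M1 C2 M2
    |phi1 phi2 h C1 M1 C2 M2|p hp C1 M1 C2 M2|phi C M I hI] t t0 s.
- exact: D.
- exact: D.
- apply: le_trans (M1 _ (ert_nonneg C2 t0) s).
  by apply: awp_le; [exact: awp_nonneg | exact: ert_nonneg | exact: M2].
- apply/D/max_le; (apply: lee_wpmul2l; first exact: iv_ge0); [exact: M1 | exact: M2].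
- by apply/D/pconv_le; [exact: hp | exact: M1 | exact: M2].
- rewrite ert_whileE; apply: lfp_mono => g g0 u; apply/D; rewrite !loopFE.
  by case: ifP => // _; exact: M.
Qed.

Definition rsum (l : seq (R * States)) (g : States -> R) : R :=
  (\sum_(x <- l) x.1 * g x.2)%R.

Lemma wsum_EFin l g : wsum l (fun s => (g s)%:E) = (rsum l g)%:E.
Proof. by rewrite /wsum /rsum -sumEFin. Qed.

Lemma rsum_le l g h : wpos l -> (forall s, g s <= h s)%R -> (rsum l g <= rsum l h)%R.
Proof.
move=> + gh; rewrite /rsum; elim: l => [|x l IH] /=; first by rewrite !big_nil.
by move=> /andP[x0 l0]; rewrite !big_cons lerD ?ler_wpM2l ?IH.
Qed.

Lemma rsum_lin l a g h :
  (rsum l (fun s => a * g s + h s) = a * rsum l g + rsum l h)%R.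
Proof.
rewrite /rsum mulr_sumr -big_split /=; apply: eq_bigr => x _; ring.
Qed.

Lemma dPAST_lower_bound phi C I hI f :
  nonneg f -> exp_le I (loopF phi f (awp C) I) ->
  dPAST (While phi C I hI) -> suitable_OST (While phi C I hI) f ->
  exp_le I (awp (While phi C I hI) f).
Proof.
move=> f0 Isub; set W := While phi C I hI => Wfin [_ [_ [Ify [_ [b [b0 Ib]]]]]].
apply: excess_eq0 => //; rewrite -/W.
set d := excess I (awp W f); have d0 : nonneg d by exact: excess_ge0.
have dI : exp_le d I by apply: excess_le => //; exact: awp_nonneg.
have dsub : forall s, d s <= iv (phi s) * awp C d s by exact: excess_subinv.
have Ifin s : I s \is a fin_num by rewrite ge0_fin_numE.
have dfin s : d s \is a fin_num.
  by rewrite ge0_fin_numE //; exact: le_lt_trans (dI s) _.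
pose r := ert W zero.
have z0 : nonneg zero by move=> s; exact: lexx.
have r0 : nonneg r by exact: ert_nonneg.
have rfin s : r s \is a fin_num by rewrite ge0_fin_numE //; exact: Wfin.
have rsub s : 1 + iv (phi s) * awp C r s <= r s.
  have Mr : monotone (fun g s => 1 + loopF phi zero (ert C) g s).
    by apply: cstD_monotone; apply: loopF_monotone => //; exact: ert_monotone.
  apply: le_trans (lfp_prefix Mr s); rewrite -/(r) leeD2l // loopFE.
  by case: (phi s); rewrite /iv ?mul1e ?mul0e //; exact: awp_le_ert.
pose toR (g : Exp) s := fine (g s).
have bound (eps : R) : (0 < eps)%R -> forall s, (toR d s <= eps * toR r s)%R.
  move=> eps0.
  (* Every state receives a minorant of [[phi] * awp C] that loses at most eps at d; the empty list
     serves outside the guard. These lists define T. *)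
  have [l lP] : {l : States -> seq (R * States) & forall s,
      [/\ wpos (l s), forall g, nonneg g -> wsum (l s) g <= iv (phi s) * awp C g s &
          d s <= wsum (l s) d + eps%:E]}.
    apply: (@choice _ _ (fun s l => [/\ wpos l,
      forall g, nonneg g -> wsum l g <= iv (phi s) * awp C g s &
      d s <= wsum l d + eps%:E])) => s.
    have := dsub s; case: (phi s); rewrite /iv.
      rewrite mul1e => ds.
      have : d s - eps%:E < approx (awp C) d s.
        apply: lt_le_trans (le_trans ds (@awp_approximable C d d0 s)).
        by rewrite lteBlDr // lteDl // lte_fin.
      case/ereal_sup_gt => _ [l [l0 lC] <-] /ltW; rewrite leeBlDr // => dl.
      by exists l; split=> // g g0; rewrite mul1e; exact: lC.
    rewrite mul0e => ds; exists [::]; split=> // [g g0|].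
      by rewrite wsum_nil mul0e.
    by rewrite wsum_nil add0e; apply: le_trans ds _; rewrite lee_fin ltW.
  have toRE g : (forall s, g s \is a fin_num) -> g = fun s => (toR g s)%:E.
    by move=> gf; apply/funext => s; rewrite fineK.
  (* The given b may be 0, whereas optional stopping asks for a positive bound. *)
  have bp : (0 < b + 1)%R by lra.
  apply: (@optional_stopping _ (fun g s => rsum (l s) g) _ _ _ _ (toR I) (b + 1)%R).
  - by move=> g h gh s; apply: rsum_le => //; case: (lP s).
  - by move=> a g h s; exact: rsum_lin.
  - move=> s; rewrite -lee_fin -wsum_EFin; have [_ lC _] := lP s.
    apply: le_trans (lC _ _) _; first by move=> t; exact: lee01.
    apply: le_trans (iv_le1 _ _) _; first by apply: awp_nonneg => t; exact: lee01.
    exact: (@awp_cst C 1%R ler01).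
  - exact: ltW.
  - by [].
  - by move=> s; rewrite fine_ge0.
  - by move=> s; rewrite fine_le.
  - move=> s; have [_ _] := lP s.
    by rewrite {1 2}(toRE d) // wsum_EFin -EFinD lee_fin.
  - move=> s; have [_ lC _] := lP s.
    rewrite -lee_fin -wsum_EFin.
    have -> : (fun t => `|toR I t - toR I s|%:E) = (fun t => `|I t - I s|).
      by apply/funext => t; rewrite (toRE I).
    apply: le_trans (lC _ _) _; first by move=> t; exact: abse_ge0.
    by apply: le_trans (Ib s) _; rewrite lee_fin; lra.
  - by move=> s; rewrite fine_ge0.
  - move=> s; have [_ lC _] := lP s; rewrite -lee_fin EFinD -wsum_EFin -toRE //.
    by rewrite fineK //; apply: le_trans (rsub s); rewrite leeD2l // lC.
move=> s; rewrite -(fineK (dfin s)) lee_fin leNgt; apply/negP => ds.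
have rs : (0 <= fine (r s))%R by rewrite fine_ge0.
have r1 : (0 < fine (r s) + 1)%R by lra.
(* With eps = d s / (r s + 1) the bound reads d s * (r s + 1) <= d s * r s, contradicting d s >
   0. *)
have := bound _ (divr_gt0 ds r1) s; rewrite /toR mulrAC ler_pdivlMr //.
nra.
Qed.

(** * Refinement *)

(** Stronger guards remove alternatives, and a removed one counts as oo in the minimum, so [dwp]
    grows. *)
Lemma dwp_impl C' C : C' -o C -> forall f, nonneg f -> exp_le (dwp C f) (dwp C' f).
Proof.
elim=> {C' C} [C|C1 C2 C3 _ H12 _ H23|C1' C2' C1 C2 _ H1 _ H2
  |p hp hp' C1' C2' C1 C2 _ H1 _ H2
  |phi1' phi2' h' phi1 phi2 h C1' C2' C1 C2 _ H1 _ H2 e1 e2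
  |phi I hI hI' C' C _ H] f f0 s.
- exact: lexx.
- exact: le_trans (H23 f f0 s) (H12 f f0 s).
- apply: le_trans (H1 _ (dwp_nonneg C2 f0) s) _.
  by apply: dwp_le; [exact: dwp_nonneg | exact: dwp_nonneg | exact: H2].
- by apply: pconv_le; [exact: hp | exact: H1 | exact: H2].
- rewrite /= /guardE; apply: min_le.
    by case E : (phi1' s); [rewrite e1 //; exact: H1 | rewrite leey].
  by case E : (phi2' s); [rewrite e2 //; exact: H2 | rewrite leey].
- by apply: lfp_loop_mono.
Qed.

Lemma awp_impl C' C : C' -o C -> forall f, nonneg f -> exp_le (awp C' f) (awp C f).
Proof.
elim=> {C' C} [C|C1 C2 C3 _ H12 _ H23|C1' C2' C1 C2 _ H1 _ H2
  |p hp hp' C1' C2' C1 C2 _ H1 _ H2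
  |phi1' phi2' h' phi1 phi2 h C1' C2' C1 C2 _ H1 _ H2 e1 e2
  |phi I hI hI' C' C _ H] f f0 s.
- exact: lexx.
- exact: le_trans (H12 f f0 s) (H23 f f0 s).
- apply: le_trans (H1 _ (awp_nonneg C2' f0) s) _.
  by apply: awp_le; [exact: awp_nonneg | exact: awp_nonneg | exact: H2].
- by apply: pconv_le; [exact: hp | exact: H1 | exact: H2].
- apply: max_le.
    case E : (phi1' s); rewrite /iv ?mul0e ?mule_ge0 ?iv_ge0 ?awp_nonneg //.
    by rewrite e1 // !mul1e; exact: H1.
  case E : (phi2' s); rewrite /iv ?mul0e ?mule_ge0 ?iv_ge0 ?awp_nonneg //.
  by rewrite e2 // !mul1e; exact: H2.
- by apply: lfp_loop_mono.
Qed.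

Lemma ert_impl C' C : C' -o C -> forall t, nonneg t -> exp_le (ert C' t) (ert C t).
Proof.
elim=> {C' C} [C|C1 C2 C3 _ H12 _ H23|C1' C2' C1 C2 _ H1 _ H2
  |p hp hp' C1' C2' C1 C2 _ H1 _ H2
  |phi1' phi2' h' phi1 phi2 h C1' C2' C1 C2 _ H1 _ H2 e1 e2
  |phi I hI hI' C' C _ H] t t0 s.
- exact: lexx.
- exact: le_trans (H12 t t0 s) (H23 t t0 s).
- apply: le_trans (H1 _ (ert_nonneg C2' t0) s) _.
  by apply: ert_le; [exact: ert_nonneg | exact: ert_nonneg | exact: H2].
- by rewrite leeD2l //; apply: pconv_le; [exact: hp | exact: H1 | exact: H2].
- rewrite leeD2l //; apply: max_le.
    case E : (phi1' s); rewrite /iv ?mul0e ?mule_ge0 ?iv_ge0 ?ert_nonneg //.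
    by rewrite e1 // !mul1e; exact: H1.
  case E : (phi2' s); rewrite /iv ?mul0e ?mule_ge0 ?iv_ge0 ?ert_nonneg //.
  by rewrite e2 // !mul1e; exact: H2.
- rewrite !ert_whileE; apply: lfp_mono => g g0 u; rewrite leeD2l // !loopFE.
  by case: ifP => // _; exact: H.
Qed.

(** * Implementations of transformed programs *)

Lemma trans_impl C f : trans C f -o C.
Proof.
elim: C f => [|x E|C1 H1 C2 H2
    |phi1 phi2 h C1 H1 C2 H2|p hp C1 H1 C2 H2|phi C H I hI] f /=.
- exact: impl_refl.
- exact: impl_refl.
- exact: impl_seq.
- by apply: impl_gchoice => // s /andP[].
- exact: impl_pchoice.
- exact: impl_while.
Qed.

(** Inversion principle for [impl], by cases on the implemented program: uses of [impl_trans] hide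
    the last congruence rule, but the outermost constructor survives them. *)
Definition impl_shape (C' C : Prog) : Prop :=
  match C with
  | Skip => C' = Skip
  | Assign x E => C' = Assign x E
  | Seq C1 C2 => exists C1' C2', [/\ C' = Seq C1' C2', C1' -o C1 & C2' -o C2]
  | GChoice phi1 phi2 _ C1 C2 => exists phi1' phi2' h' C1' C2',
      [/\ C' = GChoice phi1' phi2' h' C1' C2', C1' -o C1, C2' -o C2,
          entails phi1' phi1 & entails phi2' phi2]
  | PChoice p _ C1 C2 => exists hp' C1' C2',
      [/\ C' = PChoice p hp' C1' C2', C1' -o C1 & C2' -o C2]
  | While phi C J _ => exists hJ C1', C' = While phi C1' J hJ /\ C1' -o C
  end.

Lemma impl_inv C' C : C' -o C -> impl_shape C' C.
Proof.
elim=> {C' C} [C|C1 C2 C3 _ H12 _ H23|C1' C2' C1 C2 H1 _ H2 _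
  |p hp hp' C1' C2' C1 C2 H1 _ H2 _
  |phi1' phi2' h' phi1 phi2 h C1' C2' C1 C2 H1 _ H2 _ e1 e2
  |phi I hI hI' C' C H _].
- case: C => [|x E|C1 C2|phi1 phi2 h C1 C2|p hp C1 C2|phi C I hI] //=.
  + by exists C1, C2; split=> //; exact: impl_refl.
  + by exists phi1, phi2, h, C1, C2; split=> //; exact: impl_refl.
  + by exists hp, C1, C2; split=> //; exact: impl_refl.
  + by exists hI, C; split=> //; exact: impl_refl.
- move: H23 H12; case: C3 => [|x E|D1 D2|phi1 phi2 h D1 D2|p hp D1 D2|phi D I hI] /=.
  + by move=> ->.
  + by move=> ->.
  + move=> [E1 [E2 [-> i1 i2]]] /= [F1 [F2 [-> j1 j2]]].
    by exists F1, F2; split=> //; [exact: impl_trans i1 | exact: impl_trans i2].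
  + move=> [a1 [a2 [k [E1 [E2 [-> i1 i2 e1 e2]]]]]] /=.
    move=> [b1 [b2 [k' [F1 [F2 [-> j1 j2 e1' e2']]]]]].
    exists b1, b2, k', F1, F2; split=> //.
    * exact: impl_trans i1.
    * exact: impl_trans i2.
    * by move=> s /e1' /e1.
    * by move=> s /e2' /e2.
  + move=> [k [E1 [E2 [-> i1 i2]]]] /= [k' [F1 [F2 [-> j1 j2]]]].
    by exists k', F1, F2; split=> //; [exact: impl_trans i1 | exact: impl_trans i2].
  + move=> [k [E1 [-> i1]]] /= [k' [F1 [-> j1]]].
    by exists k', F1; split=> //; exact: impl_trans i1.
- by exists C1', C2'.
- by exists hp', C1', C2'.
- by exists phi1', phi2', h', C1', C2'.
- by exists hI', C'.
Qed.

(** The new guards keep only branches whose [awps] attains the maximum, and an implementation leaves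
    at least one of them enabled. At loops the annotation is unchanged. *)
Lemma awps_impl_trans C C' f : nonneg f -> C' -o trans C f -> awps C' f = awps C f.
Proof.
elim: C C' f => [|x E|C1 H1 C2 H2
    |phi1 phi2 h C1 H1 C2 H2|p hp C1 H1 C2 H2|phi C H I hI] C' f f0 /impl_inv /=.
- by move=> ->.
- by move=> ->.
- move=> [D1 [D2 [-> i1 i2]]] /=.
  by rewrite (H2 _ _ f0 i2) (H1 _ _ (awps_nonneg C2 f0) i1).
- move=> [a1 [a2 [k [D1 [D2 [-> i1 i2 e1 e2]]]]]] /=.
  rewrite (H1 _ _ f0 i1) (H2 _ _ f0 i2); apply/funext => s.
  have x0 := awps_nonneg C1 f0 s; have y0 := awps_nonneg C2 f0 s.
  have := k s; have := e1 s; have := e2 s; rewrite /psi1 /psi2 /iv.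
  case: (a1 s); case: (a2 s) => //= E2 E1 _;
    [have {E1} := E1 isT; have {E2} := E2 isT | have {E1 E2} := E1 isT | have {E1 E2} := E2 isT];
    case: (phi1 s); case: (phi2 s) => //=; rewrite ?mul1e ?mul0e // => le.
  + by rewrite !max_l.
  + by rewrite max_r // max_r.
- by move=> [k [D1 [D2 [-> i1 i2]]]] /=; rewrite (H1 _ _ f0 i1) (H2 _ _ f0 i2).
- by move=> [k [D [-> _]]].
Qed.

(** * Reduction of both properties to loops *)

(** By structural induction only loops remain. The induction hypothesis for the body turns the
    subinvariant for [awps] into one for [awp]. *)
Lemma yields_lower_bounds_loops (P : provider) :
  (forall phi C I hI f, P (While phi C I hI) f -> subinv (While phi C I hI) f) ->
  (forall phi C I hI f, nonneg f -> P (While phi C I hI) f ->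
     exp_le I (loopF phi f (awp C) I) -> exp_le I (awp (While phi C I hI) f)) ->
  yields_lower_bounds P.
Proof.
move=> Psub Plow.
elim=> [|x E|C1 H1 C2 H2|phi1 phi2 h C1 H1 C2 H2|p hp C1 H1 C2 H2|phi C H I hI] f f0 /=.
- by move=> _; exact: exp_le_refl.
- by move=> _; exact: exp_le_refl.
- move=> [v1 v2]; apply: exp_le_trans (H1 _ (awps_nonneg C2 f0) v1) _.
  by apply: awp_le; [exact: awps_nonneg | exact: awp_nonneg | exact: H2].
- move=> [v1 v2] s; apply: max_le; (apply: lee_wpmul2l; first exact: iv_ge0).
    exact: H1.
  exact: H2.
- move=> [v1 v2] s; apply: pconv_le; [exact: hp | exact: H1 | exact: H2].
- move=> [PW vC]; apply: Plow => // s.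
  apply: le_trans (Psub _ _ _ _ _ PW s) _; rewrite /loopF addeC leeD2l //.
  by apply: lee_wpmul2l; [exact: iv_ge0 | exact: H].
Qed.

(** Equality of [awps] keeps the postexpectation of the first part of a sequence, and at a loop it
    carries the subinvariant over. *)
Lemma preserved_by_trans_loops (P : provider) :
  (forall phi C C' I hI hI' f, nonneg f -> P (While phi C I hI) f ->
     C' -o C -> awps C' I = awps C I -> P (While phi C' I hI') f) ->
  preserved_by_trans P.
Proof.
move=> HP.
elim=> [|x E|C1 H1 C2 H2
    |phi1 phi2 h C1 H1 C2 H2|p hp C1 H1 C2 H2|phi C H I hI] C' f f0 /= + /impl_inv /=.
- by move=> _ ->.
- by move=> _ ->.
- move=> [v1 v2] [D1 [D2 [-> i1 i2]]] /=; rewrite (awps_impl_trans f0 i2).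
  by split; [apply: H1 v1 i1; exact: awps_nonneg | exact: H2 v2 i2].
- move=> [v1 v2] [a1 [a2 [k [D1 [D2 [-> i1 i2 _ _]]]]]] /=.
  by split; [exact: H1 v1 i1 | exact: H2 v2 i2].
- move=> [v1 v2] [k [D1 [D2 [-> i1 i2]]]] /=.
  by split; [exact: H1 v1 i1 | exact: H2 v2 i2].
- move=> [PW vC] [k [D [-> i]]] /=; split; last exact: H vC i.
  apply: HP PW _ _ => //; last exact: awps_impl_trans.
  exact: impl_trans i (trans_impl C I).
Qed.

Lemma subinv_impl phi C C' I hI hI' f : awps C' I = awps C I ->
  subinv (While phi C I hI) f -> subinv (While phi C' I hI') f.
Proof. by move=> /= ->. Qed.

Lemma dAST_impl C C' : C' -o C -> dAST C -> dAST C'.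
Proof.
move=> i CT; have o0 : nonneg one by move=> s; exact: lee01.
apply/funext => s; apply/le_anti/andP; split; last by rewrite -{1}CT; exact: dwp_impl.
have z0 : nonneg zero by move=> t; exact: lexx.
(* The upper bound 1 is the duality with d = 0 and e = 1. *)
have dual : dwp C' one s + awp C' zero s <= 1.
  by rewrite addeC; apply: (@awp_dwp_le C' 1%R) => // t; rewrite add0e.
by apply: le_trans dual; rewrite leeDl // awp_nonneg.
Qed.

Lemma dPAST_impl C C' : C' -o C -> dPAST C -> dPAST C'.
Proof.
move=> i CT s; apply: le_lt_trans (CT s).
by apply: ert_impl => // t; exact: lexx.
Qed.

(** Only the clauses that mention [awp] of the body change; both bound it from above, and
    implementations shrink it. *)
Lemma suitable_OST_impl phi C C' I hI hI' f : nonneg f -> C' -o C ->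
  suitable_OST (While phi C I hI) f -> suitable_OST (While phi C' I hI') f.
Proof.
move=> f0 i [sI [ffin [Ifin [Kfin [b [b0 Ib]]]]]]; do 3!split=> //; split.
  move=> s; apply: le_lt_trans (Kfin s); rewrite leeD2r //.
  by apply: lee_wpmul2l; [exact: iv_ge0 | exact: awp_impl].
exists b; split=> // s; apply: le_trans (Ib s).
by apply: lee_wpmul2l; [exact: iv_ge0 | apply: awp_impl => // t; exact: abse_ge0].
Qed.

Theorem theorem6p9 :
  (yields_lower_bounds dASTSUBINV /\ preserved_by_trans dASTSUBINV) /\
  (yields_lower_bounds dPASTSUBINV /\ preserved_by_trans dPASTSUBINV).
Proof.
split; split.
- apply: yields_lower_bounds_loops => phi C I hI f; first by case.
  by move=> f0 [_ [Wd [b [b0 [Ib _]]]]] Isub; exact: dAST_lower_bound b0 Ib Wd.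
- apply: preserved_by_trans_loops => phi C C' I hI hI' f f0 [sub [Wd bd]] i e.
  split; first exact: subinv_impl sub.
  by split=> //; apply: dAST_impl Wd; exact: impl_while.
- apply: yields_lower_bounds_loops => phi C I hI f; first by case.
  by move=> f0 [_ [Wd Wo]] Isub; exact: dPAST_lower_bound.
- apply: preserved_by_trans_loops => phi C C' I hI hI' f f0 [sub [Wd Wo]] i e.
  split; first exact: subinv_impl sub.
  split; first by apply: dPAST_impl Wd; exact: impl_while.
  exact: suitable_OST_impl Wo.
Qed.
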